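(* Let $\{\mathcal S_j\}_{j=1}^{n_s}$ be pairwise disjoint shapes in $D$, put $$P_j=\int_{\mathcal S_j}\big(\Pi_{in}(x)-\Pi_{ex}(x)\big)^+dx,\qquad Q_j=\int_{\mathcal S_j}\big(\Pi_{ex}(x)-\Pi_{in}(x)\big)^+dx,$$ and order the indices $\{1,\dots,n_s\}=\{j_1,\dots,j_{n_s}\}$ so that $$P_{j_1}-Q_{j_1}\le\cdots\le P_{j_m}-Q_{j_m}<0\le P_{j_{m+1}}-Q_{j_{m+1}}\le\cdots\le P_{j_{n_s}}-Q_{j_{n_s}}.$$ Let $s\ge 1$ be an integer with $s\le m$ and suppose the $s$-th inequality in this chain (the one immediately following $P_{j_s}-Q_{j_s}$) is strict. Let $\mathcal I_\oplus^*$ be the solution of the problem $$\min_{\mathcal I_\oplus\subset\{1,\dots,n_s\}}\ \int_{\bigcup_{j\in\mathcal I_\oplus}\mathcal S_j}\big(\Pi_{in}(x)-\Pi_{ex}(x)\big)\,dx\quad\text{s.t.}\quad|\mathcal I_\oplus|\le s$$ (which under these assumptions is unique, $\mathcal I_\oplus^*=\{j_1,\dots,j_s\}$). Then, for $\tau=s$, the convex program $$\min_{\alpha\in\mathbb R^{n_s},\ \|\alpha\|_1\le\tau}\ \int_D\max\Big(\big(\Pi_{in}(x)-\Pi_{ex}(x)\big)\mathcal L_\alpha(x),\ \big(\Pi_{in}(x)-\Pi_{ex}(x)\big)^-\Big)dx$$ has a unique minimizer $\alpha^*$, and $\mathcal I_\oplus^*=\{j:\alpha_j^*=1\}$.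
   Context: $D\subset\mathbb R^d$ is the imaging domain and $\Pi_{in},\Pi_{ex}:D\to[0,\infty)$ are fixed integrable inhomogeneity measures. A shape is a closed subset of $D$ that is not Lebesgue-null. Two shapes are called disjoint if their intersection is a Lebesgue-null set. $\mathcal L_\alpha(x)=\sum_{j=1}^{n_s}\alpha_j\chi_{\mathcal S_j}(x)$, where $\chi_{\mathcal S}$ is the characteristic function of $\mathcal S$. For a real number $t$, $t^+=\max(t,0)$ and $t^-=\min(t,0)$. *)

(* Defs.v *)
From HB Require Import structures.
From mathcomp Require Import all_boot all_order all_algebra.
From mathcomp Require Import all_classical all_reals all_analysis.

Set Implicit Arguments.
Unset Strict Implicit.
Unset Printing Implicit Defensive.
Import Order.TTheory GRing.Theory Num.Theory.
Import numFieldNormedType.Exports.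

Local Open Scope classical_set_scope.
Local Open Scope ring_scope.

(* The library has Lebesgue measure only on the line.  On R^d, d >= 1 (written
   d.+1: in R^0 the empty set would get outer measure 1), it is obtained by
   Caratheodory's construction from the outer measure given by countable
   covers by half-open boxes. *)
Section lebesgue_measure_Rd.
Context (R : realType) (d : nat).
Local Notation Rd := 'rV[R]_d.+1.
Implicit Types (a b : Rd) (p : Rd * Rd) (A : set Rd).

Definition box p : set Rd :=
  [set x : Rd | forall i, p.1 ord0 i < x ord0 i <= p.2 ord0 i].

Definition box_vol p : R := \prod_i Num.max 0 (p.2 ord0 i - p.1 ord0 i).

Definition box_cover A : set (nat -> Rd * Rd) :=
  [set B | A `<=` \bigcup_k box (B k)].

Definition lebesgue_outer A : \bar R :=
  ereal_inf [set (\sum_(k <oo) (box_vol (B k))%:E)%E | B in box_cover A].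

Let vol_ge0 p : (0 <= (box_vol p)%:E)%E.
Proof. by rewrite lee_fin prodr_ge0// => i _; rewrite le_max lexx. Qed.

Let box_vol00 : box_vol (0, 0) = 0.
Proof. by rewrite /box_vol big_ord_recl/= subrr maxxx mul0r. Qed.

Let lebesgue_outer_ge0 A : (0 <= lebesgue_outer A)%E.
Proof. by apply: le_ereal_inf_tmp => _ [B _ <-]; exact: nneseries_ge0. Qed.

Let lebesgue_outer0 : lebesgue_outer set0 = 0%E.
Proof.
apply/eqP; rewrite eq_le lebesgue_outer_ge0 andbT.
apply: ereal_inf_lbound; exists (fun=> (0, 0)); first by move=> ?.
by rewrite eseries0// => i _ _; rewrite box_vol00.
Qed.

Let le_lebesgue_outer :
  {homo lebesgue_outer : A B / A `<=` B >-> (A <= B)%E}.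
Proof.
move=> A B AB; apply: ereal_inf_le_tmp => _ [C BC <-].
by exists C => //; exact: subset_trans BC.
Qed.

Let lebesgue_outer_sigma_subadditive : sigma_subadditive lebesgue_outer.
Proof.
move=> A; have [[i ioo]|] := pselect (exists i, lebesgue_outer (A i) = +oo%E).
  rewrite (eseries_pinfty _ _ ioo) ?leey// => n _.
  by rewrite -ltNye (lt_le_trans _ (lebesgue_outer_ge0 _)).
rewrite -forallNE => Aoo.
suff add2e (e : {posnum R}) : (lebesgue_outer (\bigcup_n A n) <=
    \sum_(i <oo) lebesgue_outer (A i) + e%:num%:E)%E.
  by apply/lee_addgt0Pr => _/posnumP[].
rewrite (le_trans _ (epsilon_trick _ _ _))//.
pose P n (B : nat -> Rd * Rd) := box_cover (A n) B /\
  (\sum_(k <oo) (box_vol (B k))%:E <=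
   lebesgue_outer (A n) + (e%:num / (2 ^ n.+1)%:R)%:E)%E.
have [G PG] : {G : nat -> nat -> Rd * Rd & forall n, P n (G n)}.
  apply: (@choice _ _ P) => n; rewrite /P.
  have fA : lebesgue_outer (A n) \is a fin_num.
    by rewrite ge0_fin_numE// ltey; apply/eqP/Aoo.
  have en1 : 0 < e%:num / (2 ^ n.+1)%:R :> R by [].
  have [_ [B AB <-] /ltW vB] := lb_ereal_inf_adherent en1 fA.
  by exists B.
pose v := (fun ij : nat * nat => (box_vol (uncurry G ij))%:E).
have v_ge0 ij : (0 <= v ij)%E by exact: vol_ge0.
apply: (@le_trans _ _ (\esum_(i in setT) v i)%E).
  apply: ereal_inf_lbound => /=.
  have /card_esym/ppcard_eqP[f] := card_nat2.
  exists (uncurry G \o f).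
    move=> t [i _ /(PG i).1 [j _ Gt]]; exists (f^-1%FUN (i, j)) => //=.
    by rewrite invK ?inE.
  rewrite -(esum_pred_image v _ xpredT) ?[fun=> _]set_true//.
  by rewrite image_eq.
have -> : (\esum_(i in setT) v i)%E = (\sum_(i <oo) \sum_(j <oo) v (i, j))%E.
  pose J : nat -> set (nat * nat) := fun i => [set (i, j) | j in setT].
  rewrite (_ : setT = \bigcup_k J k); last first.
    by rewrite predeqE => -[a b]; split => // _; exists a => //; exists b.
  rewrite esum_bigcupT //=; last first.
    apply/trivIsetP => i j _ _ ij.
    rewrite predeqE => -[n m] /=; split => //= -[] [_] _ [<-{n} _].
    by move=> [m' _] [] /esym/eqP; rewrite (negbTE ij).
  rewrite -(image_id [set: nat]) -fun_true esum_pred_image//; last first.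
    by move=> n _; exact: esum_ge0.
  apply: eq_eseriesr => /= j _.
  rewrite -(esum_pred_image v (pair j) predT)//=; last first.
    by move=> ? ? _ _; exact: (@can_inj _ _ _ snd).
  by congr esum; rewrite predeqE => -[a b]; split; move=> [i _ <-]; exists i.
by apply: lee_nneseries => i *; [exact: nneseries_ge0|exact: (PG i).2].
Qed.

HB.instance Definition _ := isOuterMeasure.Build R Rd lebesgue_outer
  lebesgue_outer0 lebesgue_outer_ge0 le_lebesgue_outer
  lebesgue_outer_sigma_subadditive.

End lebesgue_measure_Rd.

(* R^d with the sigma-algebra of Lebesgue (= Caratheodory) measurable sets. *)
Notation Rd_lebesgue R d := (caratheodory_type (@lebesgue_outer R d)).

Definition lebesgue (R : realType) (d : nat) :
  set (Rd_lebesgue R d) -> \bar R := @lebesgue_outer R d.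

HB.instance Definition _ (R : realType) (d : nat) :=
  isMeasure.Build _ (Rd_lebesgue R d) R (@lebesgue R d)
    (@caratheodory_measure0 _ _ (@lebesgue_outer R d))
    (@caratheodory_measure_ge0 _ _ (@lebesgue_outer R d))
    (@caratheodory_measure_sigma_additive _ _ (@lebesgue_outer R d)).

Definition pos_part (R : realType) (t : R) : R := Num.max t 0.

(* Nonpositive, unlike the library's negative part max(- t, 0). *)
Definition neg_part (R : realType) (t : R) : R := Num.min t 0.

Definition minimizer (R : realType) (T : Type) (feasible : set T) (F : T -> R)
    (x : T) :=
  feasible x /\ forall y, feasible y -> F x <= F y.

Definition unique_minimizer (R : realType) (T : Type) (feasible : set T)
    (F : T -> R) (x : T) :=
  minimizer feasible F x /\ forall y, minimizer feasible F y -> y = x.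

Section shapes.
Context (R : realType) (d : nat).
Local Notation Rd := 'rV[R]_d.+1.
Local Notation leb := (@lebesgue R d).

Definition imaging_domain (D : set Rd) := measurable (D : set (Rd_lebesgue R d)).

Definition inhomogeneity (D : set Rd) (f : Rd -> R) :=
  (forall x, D x -> 0 <= f x) /\ leb.-integrable D (EFin \o f).

(* Closedness is relative to D, which need not itself be closed. *)
Definition is_shape (D S : set Rd) :=
  (exists2 C : set Rd, closed C & S = D `&` C) /\ ~ leb.-negligible S.

Definition disjoint_shapes (S1 S2 : set Rd) := leb.-negligible (S1 `&` S2).

Context (n : nat) (S : 'I_n -> set Rd).

Definition shape_comb (alpha : 'rV[R]_n) (x : Rd) : R :=
  \sum_j alpha ord0 j * \1_(S j) x.

Definition l1_norm (alpha : 'rV[R]_n) : R := \sum_j `|alpha ord0 j|.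

Definition union_cost (Pin Pex : Rd -> R) (I : {set 'I_n}) : R :=
  \int[leb]_(x in \bigcup_(j in [set` I]) S j) (Pin x - Pex x).

Definition convex_cost (D : set Rd) (Pin Pex : Rd -> R)
    (alpha : 'rV[R]_n) : R :=
  \int[leb]_(x in D) Num.max ((Pin x - Pex x) * shape_comb alpha x)
                             (neg_part (Pin x - Pex x)).

End shapes.

(* Main.v *)
Require Import Defs.
From mathcomp Require Import all_boot all_order all_algebra perm ring lra.
From mathcomp Require Import all_classical all_reals all_analysis.
From mathcomp Require Import measurable_realfun.

Set Implicit Arguments.
Unset Strict Implicit.
Unset Printing Implicit Defensive.
Import Order.TTheory GRing.Theory Num.Theory.
Import numFieldNormedType.Exports.

Local Open Scope classical_set_scope.
Local Open Scope ring_scope.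

(** Write f = Pin - Pex and c_j = P_j - Q_j, the integral of f over S_j.  Since
    the shapes overlap only in null sets, both objectives split into sums over
    the shapes.  The combinatorial cost of I is the sum of the c_j, j in I.  On
    S_j, off the overlaps, the combination of characteristic functions is the
    constant alpha_j, and the pointwise identity max_scale_split shows that the
    contribution of S_j to the convex cost is
      phi_j(alpha_j) = P_j max(alpha_j, 0) - Q_j min(alpha_j, 1);
    outside all shapes the integrand vanishes.

    The function phi_j is c_j a on [0, 1], and as P_j and Q_j are nonnegative
    it does not decrease when a moves away from [0, 1].  Clamping alpha to
    [0, 1] thus increases neither the convex cost nor the l1 norm, and both
    problems relax to minimizing sum_j c_j b_j over 0 <= b_j <= 1 and
    sum_j b_j <= s.  Let lam be the s-th smallest c_j; it is negative, and the
    strict inequality places exactly the s indices of Istar at or below lam.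
    The identity lp_gap, in which lam is the multiplier of the budget
    constraint, writes the excess of b over the indicator of Istar as a sum of
    nonnegative terms that vanish together only at that indicator.  If clamping
    alpha yields the indicator of Istar, whose sum is already s, the bound
    |alpha|_1 <= s leaves no room outside [0, 1], so that alpha itself is the
    indicator.

    For the integrals to split, the shapes must be measurable.  A half-space
    cuts a box into two boxes whose volumes add up, so it satisfies
    Caratheodory's criterion for the box-covering outer measure; boxes, then
    open sets and closed sets, follow. *)

(** * Measurability of closed sets for the box-covering outer measure *)

Section borel.
Context (R : realType) (d : nat).
Local Notation Rd := 'rV[R]_d.+1.

Definition set_coord (v : Rd) (i : 'I_d.+1) (t : R) : Rd :=
  \row_j (if j == i then t else v ord0 j).

Definition box_below i t (p : Rd * Rd) : Rd * Rd :=
  (p.1, set_coord p.2 i (Num.min (p.2 ord0 i) t)).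
Definition box_above i t (p : Rd * Rd) : Rd * Rd :=
  (set_coord p.1 i (Num.max (p.1 ord0 i) t), p.2).

Lemma box_belowE i t p : box (box_below i t p) = box p `&` [set x | x ord0 i <= t].
Proof.
apply/seteqP; split => x /=.
  move=> xp; split => [j|].
    move: (xp j); rewrite mxE; case: eqP => [->|//].
    by rewrite le_min => /and3P[-> ->].
  by move: (xp i); rewrite mxE eqxx le_min => /and3P[].
move=> [xp xt] j; rewrite mxE; case: eqP => [->|_]; last exact: xp.
by rewrite le_min xt andbT; exact: xp.
Qed.

Lemma box_aboveE i t p : box (box_above i t p) = box p `&` [set x | t < x ord0 i].
Proof.
apply/seteqP; split => x /=.
  move=> xp; split => [j|].
    move: (xp j); rewrite mxE; case: eqP => [->|//].
    by rewrite gt_max => /andP[/andP[-> _] ->].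
  by move: (xp i); rewrite mxE eqxx gt_max => /andP[/andP[]].
move=> [xp xt] j; rewrite mxE; case: eqP => [->|_]; last exact: xp.
by rewrite gt_max xt andbT; exact: xp.
Qed.

Lemma box_vol_split i t p :
  box_vol (box_below i t p) + box_vol (box_above i t p) = box_vol p.
Proof.
pose rest := \prod_(j | j != i) Num.max 0 (p.2 ord0 j - p.1 ord0 j).
have volE (q : Rd * Rd) : (forall j, j != i -> q.1 ord0 j = p.1 ord0 j) ->
    (forall j, j != i -> q.2 ord0 j = p.2 ord0 j) ->
    box_vol q = Num.max 0 (q.2 ord0 i - q.1 ord0 i) * rest.
  move=> q1 q2; rewrite /box_vol (bigD1 i)//=; congr (_ * _).
  by apply: eq_bigr => j ji; rewrite q1// q2.
rewrite !volE// => [|j /negPf ji|j /negPf ji]; rewrite ?mxE ?ji//.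
rewrite !eqxx -mulrDl; congr (_ * _).
move: (p.1 ord0 i) (p.2 ord0 i) => a b.
rewrite !maxEle !minEle; do ?[case: ifPn]; rewrite -?ltNge; lra.
Qed.

(** Cutting every box of a cover of X by the hyperplane yields covers of the
    two parts of X with the same total volume. *)
Lemma half_space_caratheodory i t :
  (@lebesgue_outer R d).-caratheodory [set x : Rd | x ord0 i <= t].
Proof.
apply: le_caratheodory_measurable => X.
apply: le_ereal_inf_tmp => _ [B XB <-].
have -> : (\sum_(k <oo) (box_vol (B k))%:E = \sum_(k <oo)
    ((box_vol (box_below i t (B k)))%:E + (box_vol (box_above i t (B k)))%:E))%E.
  by apply: eq_eseriesr => k _; rewrite -EFinD box_vol_split.
have v0 (p : Rd * Rd) : (0 <= (box_vol p)%:E)%E.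
  by rewrite lee_fin prodr_ge0// => j _; rewrite le_max lexx.
rewrite nneseriesD//; apply: leeD; apply: ereal_inf_lbound.
  exists (box_below i t \o B) => // x [/XB[k _ xk] xt].
  by exists k => //=; rewrite box_belowE.
exists (box_above i t \o B) => // x [/XB[k _ xk] /= /negP]; rewrite -ltNge => xt.
by exists k => //=; rewrite box_aboveE.
Qed.

Lemma measurable_box (p : Rd * Rd) : measurable (box p : set (Rd_lebesgue R d)).
Proof.
have -> : box p = \bigcap_(j in setT)
   ([set x | x ord0 j <= p.2 ord0 j] `&` ~` [set x | x ord0 j <= p.1 ord0 j]).
  apply/seteqP; split => x /= xp j.
    by move=> _; case/andP: (xp j) => lo hi; split => //=; apply/negP; rewrite -ltNge.
  by have [/= hi /negP] := xp j I; rewrite -ltNge => ->.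
apply: fin_bigcap_measurable => [|j _]; first exact: finite_finset.
apply: measurableI; first exact: half_space_caratheodory.
by apply: measurableC; exact: half_space_caratheodory.
Qed.

(** An open set is the union of the boxes with rational corners that it
    contains, and there are countably many of these. *)
Lemma open_measurable_Rd (U : set Rd) :
  open U -> measurable (U : set (Rd_lebesgue R d)).
Proof.
move=> oU.
pose qbox (p : 'rV[rat]_d.+1 * 'rV[rat]_d.+1) : Rd * Rd :=
  (map_mx ratr p.1, map_mx ratr p.2).
(* A box that is not contained in U contributes the empty set, so that p ranges
   over a whole countable type. *)
pose F p : set Rd := [set x | box (qbox p) x /\ box (qbox p) `<=` U].
have -> : U = \bigcup_p F p.
  apply/seteqP; split => [x Ux|x [p _ [xp]]]; last exact.
  have /nbhs_ballP[e /= e0 eU] : nbhs x U by exact: open_nbhs_nbhs.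
  have a j : {q : rat | ratr q \in `]x ord0 j - e, x ord0 j[}.
    by apply/cid/rat_in_itvoo; rewrite ltrBlDr ltrDl.
  have b j : {q : rat | ratr q \in `]x ord0 j, x ord0 j + e[}.
    by apply/cid/rat_in_itvoo; rewrite ltrDl.
  exists (\row_j sval (a j), \row_j sval (b j)) => //; split.
    move=> j /=; rewrite !mxE.
    case: (a j) (b j) => [q + [r +]] /=; rewrite !in_itv/=.
    by move=> /andP[_ ->] /andP[/ltW ->].
  move=> y /= yab; apply: eU; split => // i j; rewrite ord1 /ball/=.
  move: (yab j); rewrite /= !mxE.
  case: (a j) (b j) => [q + [r +]] /=; rewrite !in_itv/=.
  move=> /andP[q1 _] /andP[_ r1] /andP[qy yr].
  by rewrite ltr_distlC; apply/andP; split; [apply: lt_trans qy|apply: le_lt_trans r1].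
apply: (@countable_bigcupT_measurable _ (Rd_lebesgue R d)) => [|p]; first exact: countableP.
have [pU|pU] := pselect (box (qbox p) `<=` U).
  have -> : F p = box (qbox p) by apply/seteqP; split => [x []|x].
  exact: measurable_box.
have -> : F p = set0 by apply/seteqP; split => [x []|x].
exact: measurable0.
Qed.

Lemma closed_measurable_Rd (C : set Rd) :
  closed C -> measurable (C : set (Rd_lebesgue R d)).
Proof.
by move=> cC; rewrite -(setCK C); apply/measurableC/open_measurable_Rd/closed_openC.
Qed.

End borel.

(** * Integrals over almost disjoint families *)

Section AlmostDisjoint.
Context {disp : measure_display} {T : measurableType disp} {R : realType}.
Variable mu : {measure set T -> \bar R}.

Lemma Rintegral_sum (D : set T) (I : Type) (r : seq I) (f : I -> T -> R) :
    measurable D -> (forall i, mu.-integrable D (EFin \o f i)) ->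
  \int[mu]_(x in D) (\sum_(i <- r) f i x) = \sum_(i <- r) \int[mu]_(x in D) f i x.
Proof.
move=> mD fi; rewrite /Rintegral.
under eq_integral do rewrite -sumEFin.
rewrite integral_sum//.
rewrite sum_fine// => i _; exact: (integrable_fin_num mD (fi i)).
Qed.

(** Almost every point of D lies in at most one S_j, so g is almost everywhere
    the sum of the extensions by zero of the h_j. *)
Lemma Rintegral_almost_disjoint (D : set T) (n : nat) (S : 'I_n -> set T)
    (g : T -> R) (h : 'I_n -> T -> R) :
    measurable D -> (forall j, measurable (S j)) -> (forall j, S j `<=` D) ->
    (forall i j : 'I_n, i != j -> mu.-negligible (S i `&` S j)) ->
    measurable_fun D g ->
    (forall j, mu.-integrable (S j) (EFin \o h j)) ->
    (forall x, D x -> (forall j, ~ S j x) -> g x = 0) ->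
    (forall j x, S j x -> (forall i, S i x -> i = j) -> g x = h j x) ->
  \int[mu]_(x in D) g x = \sum_j \int[mu]_(x in S j) h j x.
Proof.
move=> mD mS SD dS mg ih g0 gh.
have ihD j : mu.-integrable D (EFin \o (h j \_ (S j))).
  rewrite -restrict_EFin; apply: (@integrableS _ _ _ _ setT) => //.
  by rewrite -integrable_mkcond.
have -> : \sum_j \int[mu]_(x in S j) h j x =
    \int[mu]_(x in D) (\sum_j (h j \_ (S j)) x).
  rewrite Rintegral_sum//; apply: eq_bigr => j _.
  by rewrite -Rintegral_mkcondr setIidr.
congr fine; apply: ae_eq_integral => //.
- exact/measurable_EFinP.
- apply/measurable_EFinP/measurable_sum => j.
  by apply/measurable_EFinP; case/integrableP: (ihD j).
have ae_uniq : {ae mu, forall x, forall i j : 'I_n, i != j -> ~ (S i `&` S j) x}.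
  apply: filter_forall => i; apply: filter_forall => j.
  have [->|ij] := eqVneq i j; first by apply: aeW.
  by apply: negligibleS (dS _ _ ij) => x /= /not_implyP[_] /contrapT.
apply: filterS ae_uniq => x uniq_x Dx /=; congr EFin.
have [[j Sjx]|noS] := pselect (exists j, S j x).
  have eqj i : S i x -> i = j.
    by move=> Six; apply/eqP/negPn/negP => /uniq_x; exact.
  rewrite (gh j)// (bigD1 j)//= patchE mem_set// big1 ?addr0// => i ij.
  by rewrite patchE memNset// => /eqj; exact/eqP.
have nS j : ~ S j x by move=> Sjx; apply: noS; exists j.
by rewrite g0// big1// => j _; rewrite patchE memNset.
Qed.

(** Where f >= 0 only the positive part of a matters, because of the
    competitor min(f, 0) = 0; where f < 0 the competitor f caps a at 1. *)
Lemma max_scale_split (f a : R) : Num.max (f * a) (Num.min f 0) =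
  Num.max f 0 * Num.max a 0 - Num.max (- f) 0 * Num.min a 1.
Proof.
case/orP: (le_total 0 f) => f0.
  rewrite (max_idPl f0) (min_idPr f0) [Num.max (- f) 0](max_idPr _) ?oppr_le0// mul0r subr0.
  by rewrite maxr_pMr// mulr0.
rewrite (min_idPl f0) (max_idPr f0) mul0r sub0r [Num.max (- f) 0](max_idPl _) ?oppr_ge0//.
by rewrite mulNr opprK minr_nMr// mulr1.
Qed.

Lemma Rintegral_max_scale (S : set T) (f : T -> R) (a : R) :
    measurable S -> mu.-integrable S (EFin \o f) ->
  \int[mu]_(x in S) Num.max (f x * a) (Num.min (f x) 0) =
  (\int[mu]_(x in S) Num.max (f x) 0) * Num.max a 0 -
  (\int[mu]_(x in S) Num.max (- f x) 0) * Num.min a 1.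
Proof.
move=> mS fS.
have ipos : mu.-integrable S (EFin \o (fun x => Num.max (f x) 0)).
  exact: integrable_funrpos.
have ineg : mu.-integrable S (EFin \o (fun x => Num.max (- f x) 0)).
  exact: integrable_funrneg.
under eq_Rintegral do rewrite max_scale_split.
rewrite RintegralB//; last 2 first.
- exact: (integrableZr mS (Num.max a 0) ipos).
- exact: (integrableZr mS (Num.min a 1) ineg).
by rewrite !RintegralZr.
Qed.

Lemma Rintegral_posnegB (S : set T) (f : T -> R) :
    measurable S -> mu.-integrable S (EFin \o f) ->
  \int[mu]_(x in S) f x =
  \int[mu]_(x in S) Num.max (f x) 0 - \int[mu]_(x in S) Num.max (- f x) 0.
Proof.
(* For a = 1 the integrand max(f, min(f, 0)) is f. *)
move=> mS fS; have := Rintegral_max_scale 1 mS fS.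
rewrite (max_idPl (@ler01 R)) minxx !mulr1 => <-.
by apply: eq_Rintegral => x _; rewrite mulr1 (max_idPl _)// ge_min lexx.
Qed.

Section costs.
Variables (D : set T) (n : nat) (S : 'I_n -> set T) (f : T -> R).
Hypotheses (mD : measurable D) (mS : forall j, measurable (S j))
  (SD : forall j, S j `<=` D) (if_ : mu.-integrable D (EFin \o f))
  (dS : forall i j : 'I_n, i != j -> mu.-negligible (S i `&` S j)).

Let ifS j : mu.-integrable (S j) (EFin \o f).
Proof. exact: integrableS if_. Qed.

Let mf : measurable_fun D f.
Proof. by apply/measurable_EFinP; case/integrableP: if_. Qed.

Lemma Rintegral_bigcup_almost_disjoint (I : {set 'I_n}) :
  \int[mu]_(x in \bigcup_(j in [set` I]) S j) f x =
  \sum_(j in I) \int[mu]_(x in S j) f x.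
Proof.
pose U := \bigcup_(j in [set` I]) S j.
have mU : measurable U by apply: fin_bigcup_measurable => //; exact: finite_finset.
rewrite -/U -(setIidr (_ : U `<=` D)); last by move=> x [j _ /SD].
rewrite Rintegral_mkcondr.
rewrite (Rintegral_almost_disjoint (h := fun j x => (j \in I)%:R * f x) mD mS SD dS).
- rewrite [RHS]big_mkcond/=; apply: eq_bigr => j _; rewrite RintegralZl//.
  by case: (j \in I); rewrite ?mul1r ?mul0r.
- apply/(measurable_restrict _ mU) => //.
  exact: measurable_funS mf.
- by move=> j; exact: (integrableZl (mS j) (j \in I)%:R (ifS j)).
- by move=> x Dx noS; rewrite patchE memNset// => -[j _ /noS].
move=> j x Sjx uj; rewrite patchE; case: (boolP (j \in I)) => jI.
  by rewrite mem_set ?mul1r//; exists j.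
rewrite memNset ?mul0r// => -[i /= iI Six].
by move: jI; rewrite -(uj i Six) iI.
Qed.

Lemma Rintegral_max_shape_comb (a : 'I_n -> R) :
  \int[mu]_(x in D) Num.max (f x * \sum_j a j * \1_(S j) x) (Num.min (f x) 0) =
  \sum_j ((\int[mu]_(x in S j) Num.max (f x) 0) * Num.max (a j) 0 -
          (\int[mu]_(x in S j) Num.max (- f x) 0) * Num.min (a j) 1).
Proof.
rewrite (Rintegral_almost_disjoint
  (h := fun j x => Num.max (f x * a j) (Num.min (f x) 0)) mD mS SD dS).
- by apply: eq_bigr => j _; rewrite Rintegral_max_scale.
- apply: measurable_maxr; last by apply: measurable_minr.
  apply: measurable_funM => //; apply: measurable_sum => j.
  by apply: measurable_funM => //; exact: measurable_indic.
- move=> j.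
  under [X in mu.-integrable _ X]eq_fun do rewrite /= max_scale_split EFinB.
  apply: integrableB => //.
    exact: (integrableZr (mS j) (Num.max (a j) 0) (integrable_funrpos (mS j) (ifS j))).
  exact: (integrableZr (mS j) (Num.min (a j) 1) (integrable_funrneg (mS j) (ifS j))).
- move=> x Dx noS; rewrite big1 => [|j _]; last by rewrite indicE memNset ?mulr0.
  by rewrite mulr0; apply/max_idPl; rewrite ge_min lexx orbT.
move=> j x Sjx uj; rewrite (bigD1 j)//= indicE mem_set// mulr1 big1 ?addr0// => i ij.
by rewrite indicE memNset ?mulr0// => /uj; exact/eqP.
Qed.

End costs.

End AlmostDisjoint.

(** * A linear program over the cube with a threshold *)

Section threshold_lp.
Variables (R : realFieldType) (n : nat) (c : 'I_n -> R) (I : {set 'I_n}) (lam : R).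
Hypotheses (lam0 : lam < 0) (cI : forall j, j \in I -> c j <= lam)
  (cNI : forall j, j \notin I -> lam < c j).
Implicit Types b : 'I_n -> R.

Lemma sum_indicator (J : {set 'I_n}) : \sum_j (j \in J)%:R = #|J|%:R :> R.
Proof.
rewrite -natr_sum -sum1_card [in RHS]big_mkcond.
by congr _%:R; apply: eq_bigr => j _; case: ifP.
Qed.

Lemma sum_mul_indicator (J : {set 'I_n}) :
  \sum_j c j * (j \in J)%:R = \sum_(j in J) c j.
Proof.
rewrite [RHS]big_mkcond.
by apply: eq_bigr => j _; case: ifP; rewrite ?mulr1 ?mulr0.
Qed.

(** This is linear programming duality with multiplier lam for the constraint
    sum_j b_j <= #|I|: for feasible b both terms on the right are
    nonnegative. *)
Lemma lp_gap b : \sum_j c j * b j - \sum_(j in I) c j =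
  \sum_j (c j - lam) * (b j - (j \in I)%:R) + lam * (\sum_j b j - #|I|%:R).
Proof.
rewrite -sum_mul_indicator -sum_indicator -!sumrB mulr_sumr -big_split/=.
by apply: eq_bigr => j _; ring.
Qed.

Lemma lp_term_ge0 b j : 0 <= b j <= 1 -> 0 <= (c j - lam) * (b j - (j \in I)%:R).
Proof.
move=> /andP[b0 b1]; case: (boolP (j \in I)) => [/cI|/cNI] cj /=.
  by rewrite mulr_le0// subr_le0.
by rewrite subr0 mulr_ge0// subr_ge0 ltW.
Qed.

Lemma lp_min b : (forall j, 0 <= b j <= 1) -> \sum_j b j <= #|I|%:R ->
  \sum_(j in I) c j <= \sum_j c j * b j.
Proof.
move=> b01 sb; rewrite -subr_ge0 lp_gap addr_ge0//.
  by apply: sumr_ge0 => j _; exact: lp_term_ge0.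
by rewrite mulr_le0 ?subr_le0// ltW.
Qed.

(** A zero gap makes both terms of lp_gap vanish.  The sum kills b outside I,
    where c_j > lam strictly; as lam is nonzero the budget is exhausted, which
    forces b_j = 1 throughout I. *)
Lemma lp_uniq b : (forall j, 0 <= b j <= 1) -> \sum_j b j <= #|I|%:R ->
  \sum_j c j * b j <= \sum_(j in I) c j -> forall j, b j = (j \in I)%:R.
Proof.
move=> b01 sb; rewrite -subr_le0 lp_gap => gap0.
have t0 j : 0 <= (c j - lam) * (b j - (j \in I)%:R) by exact: lp_term_ge0.
have s0 : 0 <= \sum_j (c j - lam) * (b j - (j \in I)%:R) by exact: sumr_ge0.
have l0 : 0 <= lam * (\sum_j b j - #|I|%:R) by rewrite mulr_le0 ?subr_le0// ltW.
have /eqP : \sum_j (c j - lam) * (b j - (j \in I)%:R) = 0.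
  by apply/le_anti; rewrite s0 andbT (le_trans _ gap0)// lerDl.
rewrite psumr_eq0// => /allP/= eq0.
have bNI j : j \notin I -> b j = 0.
  move=> jI; move: (eq0 j); rewrite mem_index_enum => /(_ isT).
  by rewrite (negPf jI) subr0 mulf_eq0 subr_eq0 gt_eqF ?cNI//= => /eqP.
have sbE : \sum_j b j = #|I|%:R.
  apply/eqP; rewrite -subr_eq0; apply/eqP/le_anti.
  by rewrite subr_le0 sb /= -(nmulr_rle0 _ lam0) (le_trans _ gap0)// lerDr.
have /eqP : \sum_(j in I) (1 - b j) = 0.
  rewrite sumrB sumr_const -sbE [X in X - _ = _](bigID (mem I))//=.
  by rewrite [X in _ + X - _]big1 ?addr0 ?subrr// => j; exact: bNI.
rewrite psumr_eq0 => [/allP/= bI j|j _]; last by rewrite subr_ge0; case/andP: (b01 j).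
case: (boolP (j \in I)) => [jI|/bNI//].
move: (bI j); rewrite mem_index_enum jI => /(_ isT).
by rewrite subr_eq0 => /eqP <-.
Qed.

Variables P Q : 'I_n -> R.
Hypotheses (P0 : forall j, 0 <= P j) (Q0 : forall j, 0 <= Q j)
  (cPQ : forall j, c j = P j - Q j).

Definition clamp01 (a : R) : R := Num.max 0 (Num.min a 1).

Lemma clamp01_itv a : 0 <= clamp01 a <= 1.
Proof. by rewrite /clamp01 le_max lexx ge_max ler01 ge_min lexx orbT. Qed.

Lemma clamp01_le_norm a : clamp01 a <= `|a|.
Proof. by rewrite /clamp01 ge_max normr_ge0 ge_min ler_norm. Qed.

Lemma clamp01_norm a : `|a| = clamp01 a -> a = clamp01 a.
Proof.
rewrite /clamp01; case: (lerP 0 a) => [/ger0_norm->//|a0].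
by rewrite min_l ?max_l ?(ltW a0) ?(le_trans (ltW a0))// => /normr0_eq0.
Qed.

(** The right-hand side has slope P_j above 1 and - Q_j below 0, and it is
    c_j a in between. *)
Lemma clamp01_cost_le j a :
  c j * clamp01 a <= P j * Num.max a 0 - Q j * Num.min a 1.
Proof.
rewrite cPQ /clamp01; case/orP: (le_total a 0) => a0.
  have a1 : a <= 1 := le_trans a0 ler01.
  rewrite (min_idPl a1) (max_idPl a0) (max_idPr a0) !mulr0 sub0r.
  by rewrite -mulrN mulr_ge0// oppr_ge0.
rewrite (max_idPl a0); case/orP: (le_total a 1) => a1.
  by rewrite (min_idPl a1) (max_idPr a0) mulrBl.
rewrite (min_idPr a1) (max_idPr (@ler01 R)) !mulr1 lerD2r.
by rewrite ler_peMr.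
Qed.

Lemma clamped_cost_min (a : 'I_n -> R) : \sum_j `|a j| <= #|I|%:R ->
  \sum_(j in I) c j <= \sum_j (P j * Num.max (a j) 0 - Q j * Num.min (a j) 1).
Proof.
move=> sa; apply: (@le_trans _ _ (\sum_j c j * clamp01 (a j))).
  apply: lp_min => [j|]; first exact: clamp01_itv.
  by apply: le_trans sa; apply: ler_sum => j _; exact: clamp01_le_norm.
by apply: ler_sum => j _; exact: clamp01_cost_le.
Qed.

(** Clamping turns a into the indicator of I, which already exhausts the
    budget #|I|; hence |a_j| cannot exceed its clamped value anywhere. *)
Lemma clamped_cost_uniq (a : 'I_n -> R) : \sum_j `|a j| <= #|I|%:R ->
  \sum_j (P j * Num.max (a j) 0 - Q j * Num.min (a j) 1) <= \sum_(j in I) c j ->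
  forall j, a j = (j \in I)%:R.
Proof.
move=> sa ca.
have clampE j : clamp01 (a j) = (j \in I)%:R.
  apply: (lp_uniq (b := clamp01 \o a)) => [k||] /=; first exact: clamp01_itv.
    by apply: le_trans sa; apply: ler_sum => k _; exact: clamp01_le_norm.
  by apply: le_trans ca; apply: ler_sum => k _; exact: clamp01_cost_le.
have d0 k : 0 <= `|a k| - clamp01 (a k) by rewrite subr_ge0 clamp01_le_norm.
have /eqP : \sum_k (`|a k| - clamp01 (a k)) = 0.
  apply/le_anti; rewrite sumr_ge0 // andbT sumrB subr_le0 (le_trans sa)//.
  by rewrite (eq_bigr _ (fun k _ => clampE k)) sum_indicator.
rewrite psumr_eq0// => /allP/= eq0 j.
have := eq0 j; rewrite mem_index_enum => /(_ isT).
by rewrite subr_eq0 => /eqP/clamp01_norm ->.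
Qed.

Lemma clamped_cost_indicator :
  \sum_j (P j * Num.max ((j \in I)%:R) 0 - Q j * Num.min ((j \in I)%:R) 1) =
  \sum_(j in I) c j.
Proof.
rewrite [RHS]big_mkcond/=; apply: eq_bigr => j _; case: (j \in I) => /=.
  by rewrite (max_idPl (@ler01 R)) minxx !mulr1 cPQ.
by rewrite maxxx (min_idPl (@ler01 R)) !mulr0 subr0.
Qed.

End threshold_lp.

(** * The order statistics of the costs *)

Section smallest.
Variables (R : realFieldType) (n : nat) (c : 'I_n -> R) (sigma : {perm 'I_n}).
Variables (s m : nat).
Hypotheses (s1 : (1 <= s)%N) (sm : (s <= m)%N) (mn : (m <= n)%N)
  (sorted_c : forall i k : 'I_n, (i <= k)%N -> c (sigma i) <= c (sigma k))
  (neg_c : forall i : 'I_n, (i < m)%N -> c (sigma i) < 0)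
  (nonneg_c : forall i : 'I_n, (m <= i)%N -> 0 <= c (sigma i))
  (strict_c : (s < m)%N -> forall i k : 'I_n, i.+1 = s -> k = s :> nat ->
     c (sigma i) < c (sigma k)).

Definition smallest_set : {set 'I_n} := [set sigma i | i : 'I_n & (i < s)%N]%SET.

Lemma mem_smallest_set (i : 'I_n) : (sigma i \in smallest_set) = (i < s)%N.
Proof. by rewrite mem_imset ?inE//; exact: perm_inj. Qed.

Lemma card_smallest_set : #|smallest_set| = s.
Proof.
rewrite card_imset; last exact: perm_inj.
rewrite -sum1dep_card (big_ord_narrow (leq_trans sm mn)).
by rewrite sum_nat_const card_ord muln1.
Qed.

(** The threshold is the s-th smallest value.  For s < m the value that follows
    it is larger by strictness; for s = m all later values are nonnegative. *)
Lemma smallest_set_threshold : exists lam : R, [/\ lam < 0,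
  forall j, j \in smallest_set -> c j <= lam &
  forall j, j \notin smallest_set -> lam < c j].
Proof.
have ltsn : (s.-1 < n)%N by rewrite prednK// (leq_trans sm mn).
pose i0 := Ordinal ltsn.
have i0s : i0.+1 = s by rewrite /= prednK.
exists (c (sigma i0)); split => [|j|j].
- by apply: neg_c; rewrite i0s.
- by rewrite -(permKV sigma j) mem_smallest_set -i0s ltnS => /sorted_c.
rewrite -(permKV sigma j) mem_smallest_set -leqNgt => sj.
have [ltsm|lems] := ltnP s m.
  apply: (@lt_le_trans _ _ (c (sigma (Ordinal (leq_trans ltsm mn))))).
    exact: strict_c.
  exact: sorted_c.
apply: (@lt_le_trans _ _ 0); first by apply: neg_c; rewrite i0s.
by apply: nonneg_c; exact: leq_trans sj.
Qed.

End smallest.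

(** * The two optimization problems *)

(* Indices are 0-based: sigma i is the index j_(i+1). *)
Theorem theorem3p5 (R : realType) (d : nat)
    (D : set 'rV[R]_d.+1) (Pin Pex : 'rV[R]_d.+1 -> R)
    (hD : imaging_domain D)
    (hPin : inhomogeneity D Pin) (hPex : inhomogeneity D Pex)
    (n : nat) (S : 'I_n -> set 'rV[R]_d.+1)
    (hS : forall j, is_shape D (S j))
    (hdisj : forall i j : 'I_n, i != j -> disjoint_shapes (S i) (S j))
    (P Q : 'I_n -> R)
    (hP : forall j, P j = \int[@lebesgue R d]_(x in S j) pos_part (Pin x - Pex x))
    (hQ : forall j, Q j = \int[@lebesgue R d]_(x in S j) pos_part (Pex x - Pin x))
    (sigma : {perm 'I_n}) (m : nat) (hm : (m <= n)%N)
    (hsorted : forall i k : 'I_n, (i <= k)%N ->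
       P (sigma i) - Q (sigma i) <= P (sigma k) - Q (sigma k))
    (hneg : forall i : 'I_n, (i < m)%N -> P (sigma i) - Q (sigma i) < 0)
    (hnonneg : forall i : 'I_n, (m <= i)%N -> 0 <= P (sigma i) - Q (sigma i))
    (s : nat) (hs1 : (1 <= s)%N) (hsm : (s <= m)%N)
    (* for s = m the s-th inequality is the strict P_(j_m) - Q_(j_m) < 0 *)
    (hstrict : (s < m)%N -> forall i k : 'I_n, i.+1 = s -> k = s :> nat ->
       P (sigma i) - Q (sigma i) < P (sigma k) - Q (sigma k)) :
  exists (Istar : {set 'I_n}) (alpha : 'rV[R]_n),
    [/\ unique_minimizer [set I : {set 'I_n} | (#|I| <= s)%N]
          (union_cost S Pin Pex) Istar,
        Istar = [set sigma i | i : 'I_n & (i < s)%N]%SET,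
        unique_minimizer [set a : 'rV[R]_n | l1_norm a <= s%:R]
          (convex_cost S D Pin Pex) alpha &
        Istar = [set j | alpha ord0 j == 1]%SET].
Proof.
pose f x := Pin x - Pex x; pose c j := P j - Q j.
have if_ : (@lebesgue R d).-integrable D (EFin \o f).
  have [[_ iPin] [_ iPex]] := (hPin, hPex).
  exact: (integrableB hD iPin iPex).
have SD j : S j `<=` D by have [[C _ ->] _] := hS j; move=> x [].
have mS j : measurable (S j : set (Rd_lebesgue R d)).
  have [[C cC ->] _] := hS j.
  by apply: measurableI => //; exact: closed_measurable_Rd.
have QE j : Q j = \int[@lebesgue R d]_(x in S j) Num.max (- f x) 0.
  by rewrite hQ; apply: eq_Rintegral => x _; rewrite /pos_part opprB.
have P0 j : 0 <= P j.
  by rewrite hP; apply: Rintegral_ge0 => x _; rewrite le_max lexx orbT.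
have Q0 j : 0 <= Q j.
  by rewrite hQ; apply: Rintegral_ge0 => x _; rewrite le_max lexx orbT.
have ucE J : union_cost S Pin Pex J = \sum_(j in J) c j.
  rewrite /union_cost (Rintegral_bigcup_almost_disjoint hD mS SD if_ hdisj).
  apply: eq_bigr => j _; rewrite Rintegral_posnegB//; last first.
    exact: (integrableS hD (mS j) (SD j) if_).
  by rewrite /c hP QE.
have ccE a : convex_cost S D Pin Pex a =
    \sum_j (P j * Num.max (a ord0 j) 0 - Q j * Num.min (a ord0 j) 1).
  rewrite /convex_cost.
  rewrite (Rintegral_max_shape_comb hD mS SD if_ hdisj (fun j => a ord0 j)).
  by apply: eq_bigr => j _; rewrite hP QE.
pose I := smallest_set sigma s.
have cardI : #|I| = s by exact: card_smallest_set hsm hm.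
have [lam [lam0 cI cNI]] :=
  @smallest_set_threshold _ _ c sigma s m hs1 hsm hm hsorted hneg hnonneg hstrict.
have ind01 (J : {set 'I_n}) j : 0 <= ((j \in J)%:R : R) <= 1.
  by rewrite ler0n lern1 leq_b1.
exists I, (\row_j (j \in I)%:R); split => //.
- split=> [|J [/= sJ minJ]].
    split=> [|J /= sJ]; first by rewrite /= cardI.
    rewrite !ucE -(sum_mul_indicator c J); apply: (lp_min lam0 cI cNI) => //.
    by rewrite sum_indicator cardI ler_nat.
  apply/setP => j; have: (j \in J)%:R = (j \in I)%:R :> R.
    apply: (lp_uniq lam0 cI cNI (b := fun j => (j \in J)%:R)) => //.
      by rewrite sum_indicator cardI ler_nat.
    by rewrite sum_mul_indicator -!ucE; apply: minJ; rewrite /= cardI.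
  by move/eqP; rewrite eqr_nat; case: (j \in J) (j \in I) => [] [].
- have costI : convex_cost S D Pin Pex (\row_j (j \in I)%:R) = \sum_(j in I) c j.
    rewrite ccE -(clamped_cost_indicator I (fun=> erefl : c _ = P _ - Q _)).
    by apply: eq_bigr => j _; rewrite mxE.
  have feasI : l1_norm (\row_j (j \in I)%:R : 'rV[R]_n) <= s%:R.
    rewrite /l1_norm -cardI -sum_indicator ler_sum// => j _.
    by rewrite mxE ger0_norm.
  split=> [|a [/= sa mina]].
    split=> // a /= sa; rewrite costI ccE.
    by apply: (clamped_cost_min lam0 cI cNI) => //; rewrite cardI.
  apply/rowP => j; rewrite mxE.
  apply: (clamped_cost_uniq lam0 cI cNI P0 Q0) => //; first by rewrite cardI.
  by rewrite -ccE -costI; exact: mina.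
by apply/setP => j; rewrite inE mxE; case: (j \in I); rewrite ?eqxx// eq_sym oner_eq0.
Qed.
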